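(* Let $\Theta$ be an OPT. If $\Theta$ is simplicial, then there is no system in $\Theta$ satisfying the weak formulation of the superposition principle. If $\Theta$ is classical, then there is no system in $\Theta$ satisfying any formulation (ultraweak, weak, strong) of the superposition principle.
   Context: **Operational probabilistic theories (OPTs).** An OPT $\Theta$ consists of a class $\mathsf{Sys}(\Theta)$ of systems $A,B,\dots$ with a trivial system $I$ and an associative composition $(A,B)\mapsto AB$ with unit $I$ (systems may be reordered by deterministic swaps), and, for each pair $A,B$, a collection of tests $\{E_x\}_{x\in X}$ ($X$ a finite outcome set) made of events $E_x$ from $A$ to $B$; every event belongs to some test. Tests can be composed sequentially ($\circ$) and in parallel ($\boxtimes$), with identity events and the law $(\mathcal A\boxtimes\mathcal B)\circ(\mathcal C\boxtimes\mathcal D)=(\mathcal A\circ\mathcal C)\boxtimes(\mathcal B\circ\mathcal D)$ (a strict symmetric monoidal structure). Events from $I$ to $I$ are probabilities in $[0,1]$, composed by multiplication, and every test from $I$ to $I$ is a probability distribution. For a test $\{E_x\}_{x\in X}$ and $Y\subseteq X$ the coarse-graining $\sum_{y\in Y}E_y$ is an event (merging outcomes of a test gives a test), and both compositions distribute over sums. Events giving the same probabilities in all contexts are identified. States $\rho\in\mathsf{St}(A)$ are (classes of) events from $I$ to $A$; effects $a\in\mathsf{Eff}(A)$ are (classes of) events from $A$ to $I$; $(a|\rho)\in[0,1]$ is the resulting probability. An observation (test) of $A$ is a test $\{a_i\}$ of effects, i.e. from $A$ to $I$. Effects separate states and states separate effects, so $\mathsf{St}(A)$ is a subset of the real vector space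 $\mathsf{St}_{\mathbb R}(A)=\mathrm{span}_{\mathbb R}\,\mathsf{St}(A)$ and effects are linear functionals on it; sums of events are vector sums. $D_A=\dim\mathsf{St}_{\mathbb R}(A)$ is assumed finite for all $A$. The null state $\varepsilon=0$ always belongs to $\mathsf{St}(A)$. An event is deterministic if it forms a test with a single outcome (so the full coarse-graining of a test is deterministic); compositions of deterministic events are deterministic; a state is deterministic iff every deterministic effect takes value $1$ on it. Every system has at least one preparation test (input $I$) and one observation test (output $I$). $\mathsf{St}(A)$ need not be convex. **Extremal and pure states; simplicial and classical theories.** $\mathsf{ExtSt}(A)$ is the set of extreme points (extremal states) of the convex hull $\mathrm{Conv}(\mathsf{St}(A))$; it includes the null state $0$. Pure states are the deterministic extremal states. An OPT is simplicial if for every system $A$ the elements of $\mathsf{ExtSt}(A)$ are the vertices of a $D_A$-simplex, i.e. there are exactly $D_A+1$ of them, they are affinely independent, and their convex hull is $\mathrm{Conv}(\mathsf{St}(A))$. A set of states $\{\rho_i\}_{i=1}^n$ of $A$ is jointly perfectly discriminable if there is an observation test $\{a_i\}_{i=1}^n$ of $A$ with $(a_i|\rho_j)=\delta_{ij}$ for all $i,j$. A classical theory is a simplicial theory in which, for every system, the set of all pure states is jointly perfectly discriminable. **Superposition principle (for a system $A$).** Let $\mathcal D=\{\rho_i\}_{i=1}^d$, with $d\ge2$, be any maximal set of jointly perfectly discriminable pure states of $A$. Let $\mathscr A=\{a_i\}_{i=1}^d$ denote an observation such that $(a_i|\rho_j)=\delta_{ij}$ for all $i,j\in\{1,\dots,d\}$,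 $\mathbf p=\{p_i\}_{i=1}^d$ a probability distribution, and $\sigma$ a pure state of $A$. Consider the condition $( * )$: $p_i=(a_i|\sigma)$ for all $i=1,\dots,d$. The three formulations are: - ultraweak: for every choice of $\mathbf p$, there exist $\mathscr A$ and $\sigma$ such that $( * )$ holds; - weak: for every choice of $\mathbf p$ and $\mathscr A$, there exists $\sigma$ such that $( * )$ holds; - strong: for every choice of $\mathbf p$, there exists $\sigma$ such that, for every choice of $\mathscr A$, $( * )$ holds. *)

(* Defs.v *)
From mathcomp Require Import all_boot all_order all_algebra.
From mathcomp Require Import mathcomp_extra boolp classical_sets functions reals.

Set Implicit Arguments.
Unset Strict Implicit.
Unset Printing Implicit Defensive.

Import Order.TTheory GRing.Theory Num.Theory.

Local Open Scope classical_set_scope.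
Local Open Scope ring_scope.

Section ConvexGeometry.
Context (R : realType) (V : lmodType R).

Definition conv_hull (S : set V) : set V :=
  [set v | exists (n : nat) (w : 'I_n -> R) (s : 'I_n -> V),
     [/\ forall i, 0 <= w i, \sum_(i < n) w i = 1, forall i, S (s i)
       & v = \sum_(i < n) w i *: s i]].

Definition extreme_points (C : set V) : set V :=
  [set v | C v /\ forall (x y : V) (t : R), C x -> C y -> 0 < t < 1 ->
     v = t *: x + (1 - t) *: y -> x = v /\ y = v].

Definition linearly_independent (n : nat) (v : 'I_n -> V) : Prop :=
  forall c : 'I_n -> R, \sum_(i < n) c i *: v i = 0 -> forall i, c i = 0.

Definition affinely_independent (n : nat) (v : 'I_n -> V) : Prop :=
  forall c : 'I_n -> R, \sum_(i < n) c i = 0 ->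
    \sum_(i < n) c i *: v i = 0 -> forall i, c i = 0.

(* The span of S has dimension n; a basis can be extracted from S itself. *)
Definition span_dim (S : set V) (n : nat) : Prop :=
  exists v : 'I_n -> V, [/\ forall i, S (v i), linearly_independent v
    & forall x, S x -> exists c : 'I_n -> R, x = \sum_(i < n) c i *: v i].

End ConvexGeometry.

(* Tests are families indexed by
   a finite outcome type, so the same event may occur for several outcomes.
   [coarse E Y] is the coarse-graining of E over the outcomes in Y; it is a
   total function, but only its values on tests are constrained below. *)
Record opt_data (R : realType) := OptData {
  Sys : Type;
  sysI : Sys;
  sysM : Sys -> Sys -> Sys;
  Event : Sys -> Sys -> Type;
  is_test : forall (X : finType) (A B : Sys), (X -> Event A B) -> Prop;
  idE : forall A : Sys, Event A A;
  seqE : forall A B C : Sys, Event B C -> Event A B -> Event A C;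
  parE : forall A B C D : Sys,
    Event A B -> Event C D -> Event (sysM A C) (sysM B D);
  swapE : forall A B : Sys, Event (sysM A B) (sysM B A);
  coarse : forall (X : finType) (A B : Sys),
    (X -> Event A B) -> {set X} -> Event A B;
  prob : Event sysI sysI -> R
}.

Arguments sysI {R o}.
Arguments idE {R o} A.
Arguments swapE {R o} A B.

Declare Scope opt_scope.
Delimit Scope opt_scope with opt.
Local Open Scope opt_scope.
Notation "A ⊗ B" := (sysM A B) (at level 40, left associativity) : opt_scope.
Notation "F ∘ E" := (seqE F E) (at level 42, right associativity) : opt_scope.
Notation "E ⊠ F" := (parE E F) (at level 40, left associativity) : opt_scope.

Section EventsOfData.
Context (R : realType) (T : opt_data R).
Implicit Types A B C D : Sys T.

(* Transport of an event along equalities of systems, needed to state that the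
   monoidal structure is strict. *)
Definition event_cast A A' B B' (eA : A = A') (eB : B = B') (E : Event A B) :
    Event A' B' :=
  let: erefl := eA in let: erefl := eB in E.

Definition state A := Event (sysI : Sys T) A.
Definition effect A := Event A (sysI : Sys T).

Definition pairing A (a : effect A) (rho : state A) : R := prob (a ∘ rho).

Definition deterministic A B (E : Event A B) : Prop :=
  is_test (fun _ : unit => E).

(* States as vectors: rho is identified with the function a |-> (a|rho), so
   that the vector space St_R(A) is the span of [St A] in the space of real
   functions on the effects of A. *)
Definition StV A : lmodType R := (effect A -> R^o : lmodType R).

Definition vec A (rho : state A) : StV A := fun a => pairing a rho.

Definition St A : set (StV A) := range (@vec A).

End EventsOfData.

Arguments St {R T} A.

Record opt_axioms (R : realType) (T : opt_data R) : Prop := OptAxioms {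
  sysMA : forall A B C : Sys T, (A ⊗ B) ⊗ C = A ⊗ (B ⊗ C);
  sysM1 : forall A : Sys T, A ⊗ sysI = A;
  sys1M : forall A : Sys T, sysI ⊗ A = A;
  seqEA : forall (A B C D : Sys T)
      (G : Event C D) (F : Event B C) (E : Event A B),
    (G ∘ F) ∘ E = G ∘ (F ∘ E);
  seqE1 : forall (A B : Sys T) (E : Event A B), E ∘ idE A = E;
  seq1E : forall (A B : Sys T) (E : Event A B), idE B ∘ E = E;
  parE_seqE : forall (A B C A' B' C' : Sys T)
      (F : Event B C) (E : Event A B) (F' : Event B' C') (E' : Event A' B'),
    (F ⊠ F') ∘ (E ⊠ E') = (F ∘ E) ⊠ (F' ∘ E');
  parE_idE : forall A B : Sys T, idE A ⊠ idE B = idE (A ⊗ B);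
  parEA : forall (A B C A' B' C' : Sys T)
      (E : Event A A') (F : Event B B') (G : Event C C'),
    event_cast (sysMA A B C) (sysMA A' B' C') ((E ⊠ F) ⊠ G) = E ⊠ (F ⊠ G);
  parE1 : forall (A B : Sys T) (E : Event A B),
    event_cast (sysM1 A) (sysM1 B) (E ⊠ idE sysI) = E;
  par1E : forall (A B : Sys T) (E : Event A B),
    event_cast (sys1M A) (sys1M B) (idE sysI ⊠ E) = E;
  swapE_nat : forall (A B A' B' : Sys T) (E : Event A A') (F : Event B B'),
    swapE A' B' ∘ (E ⊠ F) = (F ⊠ E) ∘ swapE A B;
  swapEK : forall A B : Sys T, swapE B A ∘ swapE A B = idE (A ⊗ B);
  swapE_hexagon : forall A B C : Sys T,
    swapE A (B ⊗ C) =
    event_cast (sysMA A B C) (esym (sysMA B C A))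
      ((idE B ⊠ swapE A C) ∘
         event_cast erefl (sysMA B A C) (swapE A B ⊠ idE C));

  event_test : forall (A B : Sys T) (E : Event A B),
    exists (X : finType) (t : X -> Event A B) (x : X), is_test t /\ t x = E;
  idE_det : forall A : Sys T, deterministic (idE A);
  swapE_det : forall A B : Sys T, deterministic (swapE A B);
  seqE_test : forall (X Y : finType) (A B C : Sys T)
      (E : X -> Event A B) (F : Y -> Event B C),
    is_test E -> is_test F ->
    is_test (fun xy : X * Y => F xy.2 ∘ E xy.1);
  parE_test : forall (X Y : finType) (A B C D : Sys T)
      (E : X -> Event A B) (F : Y -> Event C D),
    is_test E -> is_test F ->
    is_test (fun xy : X * Y => E xy.1 ⊠ F xy.2);
  preparation_ex : forall A : Sys T,
    exists (X : finType) (t : X -> state A), is_test t;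
  observation_ex : forall A : Sys T,
    exists (X : finType) (t : X -> effect A), is_test t;

  prob_inj : injective (@prob R T);
  prob_ge0 : forall p : Event (sysI : Sys T) sysI, 0 <= prob p;
  prob_le1 : forall p : Event (sysI : Sys T) sysI, prob p <= 1;
  (* prob (p ⊠ q) = prob p * prob q, up to the cast along [sysM1], follows
     from this and the monoidal laws. *)
  prob_seqE : forall p q : Event (sysI : Sys T) sysI,
    prob (p ∘ q) = prob p * prob q;
  prob_test : forall (X : finType) (t : X -> Event (sysI : Sys T) sysI),
    is_test t -> \sum_(x : X) prob (t x) = 1;

  coarse1 : forall (X : finType) (A B : Sys T) (E : X -> Event A B) (x : X),
    is_test E -> coarse E [set x]%SET = E x;
  (* f merges the outcomes of the test E *)
  coarse_test : forall (X Y : finType) (A B : Sys T)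
      (E : X -> Event A B) (f : X -> Y),
    is_test E -> (forall y, exists x, f x = y) ->
    is_test (fun y : Y => coarse E [set x | f x == y]%SET);
  coarse_seqE : forall (X Y : finType) (A B C : Sys T)
      (E : X -> Event A B) (F : Y -> Event B C) (X' : {set X}) (Y' : {set Y}),
    is_test E -> is_test F ->
    coarse F Y' ∘ coarse E X' =
    coarse (fun xy : X * Y => F xy.2 ∘ E xy.1) (finset.setX X' Y');
  coarse_parE : forall (X Y : finType) (A B C D : Sys T)
      (E : X -> Event A B) (F : Y -> Event C D) (X' : {set X}) (Y' : {set Y}),
    is_test E -> is_test F ->
    coarse E X' ⊠ coarse F Y' =
    coarse (fun xy : X * Y => E xy.1 ⊠ F xy.2) (finset.setX X' Y');
  prob_coarse : forall (X : finType) (t : X -> Event (sysI : Sys T) sysI)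
      (X' : {set X}),
    is_test t -> prob (coarse t X') = \sum_(x in X') prob (t x);

  event_context : forall (A B : Sys T) (E F : Event A B),
    (forall (C : Sys T) (rho : state (A ⊗ C)) (a : effect (B ⊗ C)),
       prob (a ∘ (E ⊠ idE C) ∘ rho) = prob (a ∘ (F ⊠ idE C) ∘ rho)) ->
    E = F;
  effects_separate : forall (A : Sys T) (rho sigma : state A),
    (forall a : effect A, pairing a rho = pairing a sigma) -> rho = sigma;
  states_separate : forall (A : Sys T) (a b : effect A),
    (forall rho : state A, pairing a rho = pairing b rho) -> a = b;

  state_dim : forall A : Sys T, exists n : nat, span_dim (St A) n;
  null_state : forall A : Sys T,
    exists eps : state A, forall a : effect A, pairing a eps = 0;
  state_det : forall (A : Sys T) (rho : state A),
    deterministic rho <->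
    (forall e : effect A, deterministic e -> pairing e rho = 1)
}.

Record OPT (R : realType) := MkOPT {
  opt_of :> opt_data R;
  optP : opt_axioms opt_of
}.

Section Theories.
Context (R : realType) (T : OPT R).
Implicit Types A : Sys T.

Definition ExtSt A : set (StV A) := extreme_points (conv_hull (St A)).

Arguments ExtSt : clear implicits.

Definition pure_states A : set (state A) :=
  [set rho | deterministic rho /\ ExtSt A (vec rho)].

Arguments pure_states : clear implicits.

Definition simplicial : Prop :=
  forall A, exists (n : nat) (v : 'I_n.+1 -> StV A),
    [/\ span_dim (St A) n, injective v, ExtSt A = range v,
        affinely_independent v & conv_hull (ExtSt A) = conv_hull (St A)].

Definition discriminates A (n : nat) (a : 'I_n -> effect A)
    (rho : 'I_n -> state A) : Prop :=
  is_test a /\ forall i j, pairing (a i) (rho j) = (i == j)%:R.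

Definition jointly_discriminable A (S : set (state A)) : Prop :=
  exists (n : nat) (rho : 'I_n -> state A),
    S = range rho /\ exists a : 'I_n -> effect A, discriminates a rho.

Definition classical : Prop :=
  simplicial /\ forall A, jointly_discriminable (pure_states A).

(* [rho] enumerates, without repetition, a set of jointly perfectly
   discriminable pure states that is maximal for inclusion. *)
Definition maximal_discriminable A (d : nat) (rho : 'I_d -> state A) : Prop :=
  [/\ injective rho, range rho `<=` pure_states A,
      jointly_discriminable (range rho)
    & forall S : set (state A), S `<=` pure_states A ->
        jointly_discriminable S -> range rho `<=` S -> S = range rho].

Definition prob_distr (d : nat) (p : 'I_d -> R) : Prop :=
  (forall i, 0 <= p i) /\ \sum_(i < d) p i = 1.

Definition outcome_probs A (d : nat) (p : 'I_d -> R) (a : 'I_d -> effect A)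
    (sigma : state A) : Prop :=
  forall i, p i = pairing (a i) sigma.

Definition ultraweak_for A (d : nat) (rho : 'I_d -> state A) : Prop :=
  forall p, prob_distr p -> exists a sigma,
    [/\ discriminates a rho, pure_states A sigma & outcome_probs p a sigma].

Definition weak_for A (d : nat) (rho : 'I_d -> state A) : Prop :=
  forall p a, prob_distr p -> discriminates a rho ->
    exists sigma, pure_states A sigma /\ outcome_probs p a sigma.

Definition strong_for A (d : nat) (rho : 'I_d -> state A) : Prop :=
  forall p, prob_distr p -> exists sigma, pure_states A sigma /\
    forall a, discriminates a rho -> outcome_probs p a sigma.

(* The principle concerns systems that have some maximal set of d >= 2 jointly
   perfectly discriminable pure states; without the first conjunct every other
   system, such as the trivial one, would satisfy it vacuously. *)
Definition superposition
    (F : forall (A : Sys T) (d : nat), ('I_d -> state A) -> Prop) A : Prop :=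
  (exists (d : nat) (rho : 'I_d -> state A),
     (2 <= d)%N /\ maximal_discriminable rho) /\
  forall (d : nat) (rho : 'I_d -> state A),
    (2 <= d)%N -> maximal_discriminable rho -> F A d rho.

Definition ultraweak_superposition A : Prop := superposition ultraweak_for A.
Definition weak_superposition A : Prop := superposition weak_for A.
Definition strong_superposition A : Prop := superposition strong_for A.

End Theories.

(* Main.v *)
Require Import Defs.
From mathcomp Require Import all_boot all_order all_algebra.
From mathcomp Require Import boolp classical_sets reals.

Set Implicit Arguments.
Unset Strict Implicit.
Unset Printing Implicit Defensive.

Import Order.TTheory GRing.Theory Num.Theory.

(** In a simplicial theory a system has finitely many pure states. For a fixed
    observation a pure state determines its outcome distribution, so only
    finitely many distributions on [d >= 2] outcomes can be reached.
    In a classical theory the only maximal set of discriminable pure states is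
    the set of all pure states, on which a discriminating observation gives
    only the probabilities 0 and 1. The strong formulation implies the weak
    one. *)

Local Open Scope ring_scope.

(** A mixture of two point masses: for [i != j], varying [t] in [0, 1] yields infinitely many
    distributions. *)
Definition two_point (R : realType) (d : nat) (i j : 'I_d) (t : R) :
    'I_d -> R :=
  fun k => t * (k == i)%:R + (1 - t) * (k == j)%:R.

Lemma two_point_distr (R : realType) (d : nat) (i j : 'I_d) (t : R) :
  0 <= t <= 1 -> prob_distr (two_point i j t).
Proof.
move=> /andP[t0 t1]; split=> [k|].
  by rewrite addr_ge0 // mulr_ge0 ?ler0n // subr_ge0.
have sum_delta (k : 'I_d) : \sum_(l < d) (l == k)%:R = 1 :> R.
  by rewrite (bigD1 k) //= eqxx big1 ?addr0 // => l /negPf ->.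
by rewrite big_split /= -!big_distrr /= !sum_delta !mulr1 addrC subrK.
Qed.

Lemma two_pointE (R : realType) (d : nat) (i j : 'I_d) (t : R) :
  i != j -> two_point i j t i = t.
Proof. by move=> /negPf ij; rewrite /two_point eqxx ij mulr1 mulr0 addr0. Qed.

(** Relabelling outcomes is coarse-graining along the bijection [f]: its fibres are singletons, on
    which [coarse1] returns the original events. *)
Lemma is_test_reindex (R : realType) (T : OPT R) (X Y : finType)
    (A B : Sys T) (E : X -> Event A B) (f : X -> Y) (g : Y -> X) :
  cancel f g -> cancel g f -> is_test E -> is_test (E \o g).
Proof.
move=> fK gK testE.
have := coarse_test (optP T) (f := f) testE (fun y => ex_intro _ (g y) (gK y)).
congr is_test; apply/funext => y /=.
rewrite -(coarse1 (optP T) (g y) testE); congr coarse.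
by apply/setP => x; rewrite !inE (can2_eq fK gK).
Qed.

Lemma discriminates_inj (R : realType) (T : OPT R) (A : Sys T) (n : nat)
    (a : 'I_n -> effect A) (rho : 'I_n -> state A) :
  discriminates a rho -> injective rho.
Proof.
case=> _ a_rho i j rhoij; apply/eqP; have := a_rho i j.
rewrite -rhoij a_rho eqxx; case: (i == j) => // /eqP.
by rewrite oner_eq0.
Qed.

(** Joint discriminability comes with its own enumeration [rho'] of the set. Both enumerations are
    injective with the same range, so a bijection of indices carries the observation over to
    [rho]. *)
Lemma jointly_discriminable_range (R : realType) (T : OPT R) (A : Sys T)
    (d : nat) (rho : 'I_d -> state A) :
  injective rho -> jointly_discriminable (range rho) ->
  exists a, discriminates a rho.
Proof.
move=> rho_inj [n [rho' [rangeE [a a_rho']]]].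
have rho'_inj := discriminates_inj a_rho'.
case: a_rho' => testa a_rho'.
have /choice[g gE] (i : 'I_d) : exists k, rho' k = rho i.
  have : range rho (rho i) by exists i.
  by rewrite rangeE => -[k _ <-]; exists k.
have /choice[f fE] (k : 'I_n) : exists i, rho i = rho' k.
  have : range rho' (rho' k) by exists k.
  by rewrite -rangeE => -[i _ <-]; exists i.
have fK : cancel f g by move=> k; apply: rho'_inj; rewrite gE fE.
have gK : cancel g f by move=> i; apply: rho_inj; rewrite fE gE.
exists (a \o g); split; first exact: is_test_reindex fK gK testa.
by move=> i j /=; rewrite -gE a_rho' (can_eq gK).
Qed.

Lemma simplicial_not_weak (R : realType) (T : OPT R) (A : Sys T) :
  simplicial T -> ~ weak_superposition A.
Proof.
move=> /(_ A)[n [v [_ _ ExtE _ _]]] [[d [rho [d2 maxrho]]]].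
move=> /(_ d rho d2 maxrho) weak.
case: maxrho => rho_inj _ /(jointly_discriminable_range rho_inj)[a a_rho] _.
pose i := Ordinal (ltnW d2); pose j := Ordinal d2.
(* These are [n.+2] distinct probabilities, one more than the number of extremal states. *)
pose t (k : 'I_n.+2) : R := k.+1%:R^-1.
have t01 k : 0 <= t k <= 1.
  by rewrite invr_ge0 ler0n invf_le1 ?ltr0n // ler1n.
(* The weak principle realizes each [t k] as the probability of outcome [i] on a pure state, which
   is one of the vertices [v l]. *)
have /choice[f fE] k : exists l, v l (a i) = t k.
  have [sigma [[_ Extsigma] psigma]] :=
    weak _ a (two_point_distr i j (t01 k)) a_rho.
  move: Extsigma; rewrite ExtE => -[l _ vl]; exists l.
  by rewrite vl -(two_pointE (i := i) (j := j) (t k)) // psigma.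
suff /leq_card : injective f by rewrite !card_ord ltnn.
move=> k l fkl; have : t k = t l by rewrite -!fE fkl.
by move=> /invr_inj /eqP; rewrite eqr_nat eqSS => /eqP /val_inj.
Qed.

Lemma strong_weak (R : realType) (T : OPT R) (A : Sys T) :
  strong_superposition A -> weak_superposition A.
Proof.
move=> [ex_max strong]; split=> // d rho d2 maxrho p a pdistr a_rho.
have [sigma [pure_sigma sigmaP]] := strong d rho d2 maxrho p pdistr.
by exists sigma; split=> //; apply: sigmaP.
Qed.

Lemma classical_not_ultraweak (R : realType) (T : OPT R) (A : Sys T) :
  classical T -> ~ ultraweak_superposition A.
Proof.
move=> [_ /(_ A) disc_pure] [[d [rho [d2 maxrho]]]].
move=> /(_ d rho d2 maxrho) ultraweak.
(* Maximality is applied to the set of all pure states, itself discriminable by classicality. *)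
case: maxrho => _ rho_pure _ /(_ _ (fun _ h => h) disc_pure rho_pure) pureE.
pose i := Ordinal (ltnW d2); pose j := Ordinal d2.
have half01 : 0 <= (2^-1 : R) <= 1.
  by rewrite invr_ge0 ler0n invf_le1 ?ltr0n // ler1n.
have [a [sigma [[_ a_rho]]]] := ultraweak _ (two_point_distr i j half01).
(* Now [sigma] is some [rho k], so 1/2 would have to equal 0 or 1. *)
rewrite pureE => -[k _ <-] /(_ i); rewrite two_pointE // a_rho => /eqP.
case: (i == k); last by rewrite invr_eq0 pnatr_eq0.
by rewrite invr_eq1 pnatr_eq1.
Qed.

Local Close Scope ring_scope.

Theorem theorem5 (R : realType) (T : OPT R) :
  (simplicial T -> forall A : Sys T, ~ weak_superposition A) /\
  (classical T -> forall A : Sys T,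
     [/\ ~ ultraweak_superposition A, ~ weak_superposition A
       & ~ strong_superposition A]).
Proof.
split=> [simpT A|clT A]; first exact: simplicial_not_weak.
split; first exact: classical_not_ultraweak.
- exact: simplicial_not_weak clT.1.
- by move=> /strong_weak; apply: simplicial_not_weak clT.1.
Qed.
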